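(* Let $V$ be the complex vector space of meromorphic functions on $\mathbb{C}$, let $A = \frac{d}{dz}: V\to V$, let $B = [b_{ij}]\in\mathbb{C}^{n\times n}$ and $\vec{\varphi} = [\varphi_1\ \ldots\ \varphi_n]^T\in V^{n\times 1}$. Suppose that $\varphi_j$ is the only differentially transcendental component of $\vec{\varphi}$. Then for every solution $\vec{x} = [x_1\ \ldots\ x_n]^T\in V^{n\times 1}$ of the system $\vec{A}(\vec{x}) = B\vec{x} + \vec{\varphi}$, the corresponding entry $x_j$ is also a differentially transcendental function.
   Context: $\vec{A}$ acts componentwise: $\vec{A}(\vec{x}) = [A(x_1)\ \ldots\ A(x_n)]^T$, so the system reads $\frac{d x_i}{dz} = \sum_{l=1}^n b_{il}x_l + \varphi_i$ for $1\le i\le n$. A function $x\in V$ is differentially algebraic if it satisfies a (nontrivial) differential algebraic equation with coefficients from $\mathbb{C}$, i.e. there exist $m\ge 0$ and a nonzero polynomial $P\in\mathbb{C}[y_0,\ldots,y_m]$ with $P(x,x',\ldots,x^{(m)})=0$; otherwise $x$ is differentially transcendental. Thus ''$\varphi_j$ is the only differentially transcendental component'' means that $\varphi_j$ is differentially transcendental and all $\varphi_i$ with $i\ne j$ are differentially algebraic. *)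

(* Defs.v *)
From mathcomp Require Import all_boot all_order all_algebra.
From mathcomp Require Import complex.
From mathcomp Require Import all_classical all_reals all_analysis.
From mathcomp Require Import -(notations) mpoly.

Set Implicit Arguments.
Unset Strict Implicit.
Unset Printing Implicit Defensive.

Import Order.TTheory GRing.Theory Num.Theory.
Import numFieldNormedType.Exports.

Local Open Scope classical_set_scope.
Local Open Scope ring_scope.

(* The complex numbers, packed as a numFieldType so that the topology and the
   derivative of MathComp-Analysis, which are keyed on numFieldType, apply:
   derive1 on [Cplx R] is then the complex derivative. *)
Definition Cplx (R : realType) : numFieldType := R[i].

(* A meromorphic function is represented by a total function C -> C that has,
   around every point z0, a Laurent expansion with finite principal part
     f z = (z - z0)^(-N) * \sum_(k >= 0) a_k (z - z0)^k
   valid on a punctured neighbourhood of z0.  The values of the representative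
   at poles (and on any closed discrete set) carry no information: equality of
   meromorphic functions is [mero_eq] below, not Leibniz equality. *)
Definition meromorphic_at (R : realType) (f : Cplx R -> Cplx R) (z0 : Cplx R)
    : Prop :=
  exists (N : nat) (a : nat -> Cplx R), \forall z \near z0^',
    [series a k * (z - z0) ^+ k]_k @ \oo --> (z - z0) ^+ N * f z.

Definition meromorphic (R : realType) (f : Cplx R -> Cplx R) : Prop :=
  forall z0, meromorphic_at f z0.

(* f and g agree outside a closed discrete subset of C. *)
Definition mero_eq (R : realType) (f g : Cplx R -> Cplx R) : Prop :=
  forall z0, \forall z \near z0^', f z = g z.

(* For meromorphic f, derive1 takes an arbitrary value only on the closed
   discrete set where f is not differentiable, which [mero_eq] ignores. *)
Definition differentially_algebraic (R : realType) (f : Cplx R -> Cplx R)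
    : Prop :=
  exists (m : nat) (P : mpoly m.+1 (Cplx R)),
    P != 0 /\
    mero_eq (fun z => meval (fun k : 'I_m.+1 => derive1n k f z) P) (fun=> 0).

Definition differentially_transcendental (R : realType)
    (f : Cplx R -> Cplx R) : Prop :=
  ~ differentially_algebraic f.

(* Main.v *)
Require Import Defs.
From mathcomp Require Import all_boot all_order all_algebra.
From mathcomp Require Import complex.
From mathcomp Require Import all_classical all_reals all_analysis.
From mathcomp Require Import -(notations) mpoly.
From mathcomp Require Import zify lra ring.

Set Implicit Arguments.
Unset Strict Implicit.
Unset Printing Implicit Defensive.

Import Order.TTheory GRing.Theory Num.Theory.
Import numFieldNormedType.Exports.

Local Open Scope classical_set_scope.
Local Open Scope ring_scope.

(** Suppose that x_j were differentially algebraic.  A differentially algebraic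
    meromorphic function f lies in a finitely generated C-algebra of functions
    that is stable under d/dz: if P is an annihilating polynomial of least
    size in a given number of variables, k the order of the highest derivative
    that occurs in P and s = (dP/dy_k)(f, f', ...) the separant, then s is not
    identically zero by minimality of P, and differentiating
    P(f, f', ...) = 0 expresses s f^(k+1) polynomially in f, ..., f^(k); hence
    the algebra generated by f, ..., f^(k) and 1/s is stable under derivation
    ([algebraic_in_finite_closed]).  Joining these algebras for x_j and for the
    phi_i with i <> j, and adding all the unknowns x_l, gives again a finitely
    generated algebra: the i-th equation writes x_i' inside it for i <> j, and
    x_j' already belongs to it.  This algebra is stable under derivation, and
    by the j-th equation it contains phi_j = x_j' - sum_l b_jl x_l together with
    all its derivatives.

    Conversely every element f of a finitely generated algebra that is stable
    under derivation is differentially algebraic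
    ([finite_diff_closed_algebraic]): with e generators, the e + 1 functions
    f, f', ..., f^(e) are polynomials in e functions, and e + 1 polynomials in e
    variables are algebraically dependent, because there are more monomials in
    them of bounded degree than the dimension of the space where these live
    ([polynomials_dependent]).  So phi_j would be differentially algebraic.

    The separant argument divides by s, so it uses that a meromorphic function
    that is not identically zero has only isolated zeros
    ([identity_theorem]), applied to a polynomial in derivatives of f.  This
    requires meromorphic functions to be stable under sums, products and
    derivation.  Convergent expansions are handled through a geometric bound on
    all their remainders at once ([expansion]), for which these stability
    properties reduce to estimates of finite sums. *)

(** * Algebraic dependence of e + 1 polynomials in e variables *)

(** A matrix with more rows than columns has a nonzero row kernel; index sets
    are finite types so that boxes of exponents can be used directly. *)
Lemma wide_family_dependent (K : fieldType) (T1 T2 : finType)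
    (A : T1 -> T2 -> K) : (#|T2| < #|T1|)%N ->
  exists2 c : T1 -> K, (exists a, c a != 0) &
    forall b, \sum_a c a * A a b = 0.
Proof.
move=> ltT.
pose M : 'M[K]_(#|T1|, #|T2|) := \matrix_(i, k) A (enum_val i) (enum_val k).
have kerN0 : kermx M != 0.
  by rewrite kermx_eq0 /row_free neq_ltn (leq_ltn_trans (rank_leq_col M) ltT).
have /rowV0Pn[v /sub_kermxP vM0 vN0] := kerN0.
exists (fun a => v 0 (enum_rank a)) => [|b].
  have /rV0Pn[i vi] := vN0.
  by exists (enum_val i); rewrite enum_valK.
have := congr1 (fun w : 'rV_#|T2| => w 0 (enum_rank b)) vM0.
rewrite !mxE => vMb; rewrite -[RHS]vMb.
rewrite (reindex _ (onW_bij _ (@enum_val_bij T1))) /=.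
apply: eq_bigr => i _.
by rewrite !mxE !enum_valK enum_rankK.
Qed.

(** The count behind [polynomials_dependent]: N^(e+1) exponent vectors against
    (c N)^e coefficients, with N = c^e + 1. *)
Lemma box_count_lt (e c : nat) :
  ((c * (c ^ e).+1) ^ e < (c ^ e).+1 ^ e.+1)%N.
Proof. by rewrite expnMn expnS ltn_pmul2r ?expn_gt0. Qed.

Lemma msize_prod_exp_le (K : idomainType) (e d : nat) (I : finType)
    (Y : I -> mpoly e K) (a : I -> nat) :
  (forall i, msize (Y i) <= d.+1)%N ->
  (msize (\prod_i Y i ^+ a i) <= (\sum_i a i * d).+1)%N.
Proof.
move=> Yd.
have mulb (p q : mpoly e K) k l : (msize p <= k.+1)%N -> (msize q <= l.+1)%N ->
    (msize (p * q) <= (k + l).+1)%N.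
  have [->|p0] := eqVneq p 0; first by rewrite mul0r msize0.
  have [->|q0] := eqVneq q 0; first by rewrite mulr0 msize0.
  rewrite msizeM// => pk ql.
  by have := leq_add pk ql; lia.
elim/big_ind2 : _ => //.
- by rewrite msize1.
- by move=> p k q l; exact: mulb.
move=> i _; elim: (a i) => [|k IH]; first by rewrite expr0 msize1.
by rewrite exprS mulSn; exact: mulb.
Qed.

(** The products of powers of the Y_i with all exponents below N have degree
    less than c N, where c depends only on the degrees of the Y_i and on e.
    There are N^(e+1) of them, in a space of dimension at most (c N)^e, so for
    N > c^e they are linearly dependent; the coefficients of a linear relation
    are those of P. *)
Lemma polynomials_dependent (K : fieldType) (e : nat)
    (Y : 'I_e.+1 -> mpoly e K) :
  exists2 P : mpoly e.+1 K, P != 0 &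
    forall v : 'I_e -> K, meval (fun i => meval v (Y i)) P = 0.
Proof.
pose d := (\max_i msize (Y i))%N.
pose c := (e.+1 * d).+1.
pose N := (c ^ e).+1.
(* A finite function into 'I_r seen as an exponent vector. *)
pose box n (r : nat) (a : {ffun 'I_n -> 'I_r}) : multinom n :=
  Multinom (mktuple (fun i => a i : nat)).
have boxE n r (a : {ffun 'I_n -> 'I_r}) i : box n r a i = a i by rewrite mnmE.
pose Q (a : {ffun 'I_e.+1 -> 'I_N}) := \prod_i Y i ^+ a i.
have Qd a : (msize (Q a) <= c * N)%N.
  have Yd i : (msize (Y i) <= d.+1)%N by rewrite leqW// (leq_bigmax i).
  apply: leq_trans (msize_prod_exp_le (fun i => a i : nat) Yd) _.
  have : (\sum_(i < e.+1) a i * d <= \sum_(i < e.+1) N * d)%N.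
    by apply: leq_sum => i _; rewrite leq_mul2r ltnW ?orbT.
  rewrite sum_nat_const card_ord /c => le1.
  apply: (@leq_ltn_trans (e.+1 * (N * d))) => //.
  by rewrite [ltnRHS]mulSn mulnCA [ltnLHS]mulnC -[ltnLHS]add0n ltn_add2r.
pose A a (b : {ffun 'I_e -> 'I_(c * N)}) := mcoeff (box _ _ b) (Q a).
have [|x [a0 xa0] xA] := @wide_family_dependent _ _ _ A.
  by rewrite !card_ffun !card_ord box_count_lt.
have relQ : \sum_a x a *: Q a = 0.
  apply/mpolyP => m; rewrite mcoeff0 raddf_sum /=.
  have [mN|mN] := ltnP (mdeg m) (c * N); last first.
    apply: big1 => a _; rewrite mcoeffZ memN_msupp_eq0 ?mulr0//.
    exact/msize_mdeg_ge/(leq_trans (Qd a)).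
  have mi i : (m i < c * N)%N.
    by apply: leq_ltn_trans mN; rewrite mdegE (bigD1 i)//= leq_addr.
  pose b := [ffun i => Ordinal (mi i)].
  have -> : m = box _ _ b by apply/mnmP => i; rewrite boxE ffunE.
  by rewrite -[RHS](xA b); apply: eq_bigr => a _; rewrite mcoeffZ.
exists (\sum_a x a *: mpolyX K (box _ _ a)).
  apply: contra xa0 => /eqP /(congr1 (mcoeff (box _ _ a0))).
  rewrite mcoeff0 raddf_sum /= (bigD1 a0)//= big1 ?addr0.
    by rewrite mcoeffZ mcoeffX eqxx mulr1 => ->.
  move=> a aN; rewrite mcoeffZ mcoeffX; case: eqP => [/mnmP E|]; last by rewrite mulr0.
  move/negP: aN; case; apply/eqP/ffunP => i; apply/val_inj.
  by have := E i; rewrite !boxE.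
move=> v; rewrite raddf_sum /=.
rewrite -[RHS](meval0 v) -relQ raddf_sum /=.
apply: eq_bigr => a _; rewrite !mevalZ mevalX rmorph_prod /=; congr (_ * _).
by apply: eq_bigr => i _; rewrite boxE rmorphXn.
Qed.

(** * The modulus of a complex number as a real number *)

(** The norm of [Cplx R] takes its values in [Cplx R] itself, whose order is
    only partial; a real-valued modulus gives access to the total order and to
    the completeness of R. *)
Definition cabs (R : realType) (z : Cplx R) : R := complex.Re (`|z| : R[i]).

Section Modulus.
Local Open Scope complex_scope.
Variable R : realType.
Local Notation C := (Cplx R).
Implicit Types (z w : C) (x : R).

Lemma normr_cabs z : `|z| = (cabs z)%:C :> C.
Proof. by rewrite /cabs RRe_real// normr_real. Qed.

Lemma cabs_lt z x : (`|z| < x%:C :> C) = (cabs z < x).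
Proof. by rewrite normr_cabs ltcR. Qed.

Lemma cabs_ge0 z : 0 <= cabs z.
Proof. by rewrite -lecR -normr_cabs rmorph0 normr_ge0. Qed.

Lemma cabsM z w : cabs (z * w) = cabs z * cabs w.
Proof. by apply: complexI; rewrite rmorphM /= -!normr_cabs normrM. Qed.

Lemma cabsD z w : cabs (z + w) <= cabs z + cabs w.
Proof. by rewrite -lecR rmorphD /= -!normr_cabs ler_normD. Qed.

Lemma cabsN z : cabs (- z) = cabs z.
Proof. by apply: complexI; rewrite -!normr_cabs normrN. Qed.

Lemma cabsB z w : cabs (z - w) = cabs (w - z).
Proof. by rewrite -cabsN opprB. Qed.

Lemma cabs0 : cabs (0 : C) = 0.
Proof. by apply: complexI; rewrite -normr_cabs normr0 rmorph0. Qed.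

Lemma cabs1 : cabs (1 : C) = 1.
Proof. by apply: complexI; rewrite -normr_cabs normr1 rmorph1. Qed.

Lemma cabs_eq0 z : (cabs z == 0) = (z == 0).
Proof. by rewrite -(inj_eq (@complexI R)) -normr_cabs rmorph0 normr_eq0. Qed.

Lemma cabs_gt0 z : (0 < cabs z) = (z != 0).
Proof. by rewrite lt_def cabs_ge0 andbT cabs_eq0. Qed.

Lemma cabsX z k : cabs (z ^+ k) = cabs z ^+ k.
Proof.
by elim: k => [|k IH]; rewrite ?expr0 ?cabs1// !exprS cabsM IH.
Qed.

Lemma cabs_nat k : cabs (k%:R : C) = k%:R.
Proof. by apply: complexI; rewrite -normr_cabs normr_nat rmorph_nat. Qed.

Lemma cabs_real x : 0 <= x -> cabs (x%:C : C) = x.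
Proof. by move=> x0; apply: complexI; rewrite -normr_cabs ger0_norm// (lecR 0). Qed.

Lemma cabs_sum (I : Type) (s : seq I) (P : pred I) (F : I -> C) :
  cabs (\sum_(i <- s | P i) F i) <= \sum_(i <- s | P i) cabs (F i).
Proof.
elim/big_rec2 : _ => [|i x z _ zx]; first by rewrite cabs0.
by apply: le_trans (cabsD _ _) _; rewrite lerD2l.
Qed.

Lemma cabsE z :
  cabs z = Num.sqrt (complex.Re (z : R[i]) ^+ 2 + complex.Im (z : R[i]) ^+ 2).
Proof. by apply: complexI; rewrite -normr_cabs; exact: normc_def. Qed.

Lemma Re_le_cabs z : `|complex.Re (z : R[i])| <= cabs z.
Proof. by rewrite -sqrtr_sqr cabsE ler_sqrt ?lerDl ?addr_ge0 ?sqr_ge0. Qed.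

Lemma cabs_le_ReIm z :
  cabs z <= `|complex.Re (z : R[i])| + `|complex.Im (z : R[i])|.
Proof.
rewrite cabsE -[leRHS]ger0_norm ?addr_ge0// -sqrtr_sqr ler_sqrt ?sqr_ge0//.
rewrite sqrrD !real_normK ?num_real// lerD2r lerDl mulrn_wge0//.
Qed.

Lemma Im_le_cabs z : `|complex.Im (z : R[i])| <= cabs z.
Proof. by rewrite -sqrtr_sqr cabsE ler_sqrt ?lerDr ?addr_ge0 ?sqr_ge0. Qed.

Lemma nbhs_cabsP (z0 : C) (P : C -> Prop) : (\forall z \near z0, P z) <->
  exists2 r : R, 0 < r & forall z, cabs (z - z0) < r -> P z.
Proof.
split=> [/nbhs_ballP[e e0 eP]|[r r0 rP]].
  have [x ex] : exists x : R, e = x%:C.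
    by exists (complex.Re (e : R[i])); rewrite RRe_real// gtr0_real.
  move: e0 eP; rewrite ex => x0 eP.
  exists x => [|z zx]; first by rewrite -ltcR.
  by apply: eP; rewrite -ball_normE /= distrC cabs_lt.
apply/nbhs_ballP; exists (r%:C : C) => /=; first by rewrite (ltcR 0).
by move=> z; rewrite -ball_normE /= distrC cabs_lt; exact: rP.
Qed.

Lemma dnbhs_cabsP (z0 : C) (P : C -> Prop) : (\forall z \near z0^', P z) <->
  exists2 r : R, 0 < r & forall z, z != z0 -> cabs (z - z0) < r -> P z.
Proof.
split=> [/nbhs_cabsP[r r0 rP]|[r r0 rP]].
  by exists r => // z zz0 zr; exact: rP.
by apply/nbhs_cabsP; exists r => // z zr zz0; exact: rP.
Qed.

End Modulus.

(** * Limits with a geometric rate *)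

Section Limits.
Local Open Scope complex_scope.
Variable R : realType.
Local Notation C := (Cplx R).
Implicit Types (x y q c : R).

Lemma succn_le_exp2 k : k.+1%:R <= 2 ^+ k :> R.
Proof. by rewrite -natrX ler_nat ltn_expl. Qed.

(** Bounds that hold up to every remainder of a geometric series hold exactly.
    This replaces passing to the limit in the estimates below. *)
Lemma ler_add_geometric x y c q : 0 <= q <= 1 / 2 ->
  (forall N, x <= y + c * q ^+ N) -> x <= y.
Proof.
move=> /andP[q0 q2] xy; rewrite leNgt; apply/negP => yx.
have d0 : 0 < x - y by rewrite subr_gt0.
pose N := Num.bound (`|c| / (x - y)).
have cN : `|c| < N%:R * (x - y).
  by rewrite -ltr_pdivrMr//; apply: (archi_boundP _); rewrite divr_ge0// ltW.
have qN : q ^+ N * 2 ^+ N <= 1.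
  rewrite -exprMn; apply: exprn_ile1; first by rewrite mulr_ge0.
  by rewrite -ler_pdivlMr.
have N2 : N%:R <= 2 ^+ N :> R by apply: le_trans (succn_le_exp2 N); rewrite ler_nat.
have qN0 : 0 <= q ^+ N by rewrite exprn_ge0.
have cq : c * q ^+ N <= `|c| * q ^+ N by rewrite ler_wpM2r// ler_norm.
have := xy N.
have [qN00|qNn0] := eqVneq (q ^+ N) 0; first by rewrite qN00; lra.
have qNp : 0 < q ^+ N by rewrite lt_def qNn0.
have : `|c| * q ^+ N < N%:R * (x - y) * q ^+ N by rewrite ltr_pM2r.
have : N%:R * (x - y) * q ^+ N <= (q ^+ N * 2 ^+ N) * (x - y).
  by rewrite mulrAC [q ^+ N * _]mulrC !ler_wpM2r// ltW.
have : (q ^+ N * 2 ^+ N) * (x - y) <= 1 * (x - y) by rewrite ler_wpM2r// ltW.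
lra.
Qed.

Lemma geometric_sum_le q m n : 0 <= q <= 1 / 2 ->
  \sum_(m <= k < n) q ^+ k <= 2 * q ^+ m.
Proof.
move=> /andP[q0 q2].
have H k : \sum_(m <= i < m + k) q ^+ i <= 2 * q ^+ m - 2 * q ^+ (m + k).
  elim: k => [|k IH].
    by rewrite addn0 big_geq//; have := exprn_ge0 m q0; lra.
  rewrite addnS big_nat_recr ?leq_addr//= exprS.
  have : q * q ^+ (m + k) <= 1 / 2 * q ^+ (m + k) by rewrite ler_wpM2r ?exprn_ge0.
  by move: IH; lra.
have [mn|nm] := leqP m n.
  by have := H (n - m)%N; rewrite subnKC//; have := exprn_ge0 n q0; lra.
by rewrite big_geq ?(ltnW nm)// mulr_ge0 ?exprn_ge0.
Qed.

(** The limit is the supremum of the lower bounds p m - eps m, each of which is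
    below every upper bound p n + eps n. *)
Lemma real_limit_with_rate (p eps : nat -> R) :
  (forall n m, (n <= m)%N -> `|p m - p n| <= eps n) ->
  exists g, forall n, `|g - p n| <= eps n.
Proof.
move=> pe.
have e0 n : 0 <= eps n by apply: le_trans (pe n n (leqnn n)).
have cross n m : p m - eps m <= p n + eps n.
  have := e0 n; have := e0 m.
  have [nm|/ltnW mn] := leqP n m.
    by have := pe _ _ nm; rewrite ler_norml; lra.
  by have := pe _ _ mn; rewrite ler_norml; lra.
pose A := range (fun m => p m - eps m).
have A0 : A !=set0 by exists (p 0%N - eps 0%N); exists 0%N.
have ubA n : ubound A (p n + eps n) by move=> _ [m _ <-].
exists (sup A) => n.
have le1 : sup A <= p n + eps n by apply: ge_sup.
have le2 : p n - eps n <= sup A.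
  by apply: ub_le_sup; [exists (p 0%N + eps 0%N); exact: ubA|exists n].
by rewrite ler_norml; lra.
Qed.

(** Completeness of C, with the rate of convergence: the limit is taken on real
    and imaginary parts, hence the factor 2. *)
Lemma cplx_limit_with_rate (p : nat -> C) (eps : nat -> R) :
  (forall n m, (n <= m)%N -> cabs (p m - p n) <= eps n) ->
  exists g, forall n, cabs (g - p n) <= 2 * eps n.
Proof.
move=> pe.
have [|x xP] := @real_limit_with_rate (fun n => complex.Re (p n : R[i])) eps.
  move=> n m nm; apply: le_trans (pe n m nm).
  by rewrite -raddfB; exact: Re_le_cabs.
have [|y yP] := @real_limit_with_rate (fun n => complex.Im (p n : R[i])) eps.
  move=> n m nm; apply: le_trans (pe n m nm).
  by rewrite -raddfB; exact: Im_le_cabs.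
exists (x +i* y : C) => n; apply: le_trans (cabs_le_ReIm _) _.
by have := xP n; have := yP n; rewrite !raddfB /=; lra.
Qed.

End Limits.

(** * Functions with a convergent expansion around a point *)

Section Expansions.
Local Open Scope complex_scope.
Variable R : realType.
Local Notation C := (Cplx R).
Implicit Types (h g : C -> C) (z w : C) (a b : nat -> C) (M : R).

Definition partial_sum a w N : C := \sum_(k < N) a k * w ^+ k.

Lemma partial_sumS a w N :
  partial_sum a w N.+1 = partial_sum a w N + a N * w ^+ N.
Proof. by rewrite /partial_sum big_ord_recr. Qed.

(** [h] is the sum of the series of coefficients [a] on a punctured disc of
    radius 1/M, in the quantitative form that every remainder of order N is
    O((M|z - z0|)^N), uniformly in N.  One constant serves as inverse radius and
    as bound, so that it can be enlarged at will ([expansion_weaken]); the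
    centre is left out because values at poles are arbitrary. *)
Definition expansion h z0 a M := 1 <= M /\
  forall z, z != z0 -> M * cabs (z - z0) <= 1 ->
    forall N, cabs (h z - partial_sum a (z - z0) N)
                <= M * (M * cabs (z - z0)) ^+ N.

Definition analytic_near h z0 := exists a M, expansion h z0 a M.

Lemma expansion_weaken h z0 a M M' :
  M <= M' -> expansion h z0 a M -> expansion h z0 a M'.
Proof.
move=> MM' [M1 hM]; split; first exact: le_trans MM'.
move=> z zz0 zM' N.
have c0 := cabs_ge0 (z - z0).
have le1 : M * cabs (z - z0) <= M' * cabs (z - z0) by rewrite ler_wpM2r.
apply: le_trans (hM z zz0 (le_trans le1 zM') N) _.
have M0 : 0 <= M by lra.
apply: ler_pM => //; first by rewrite exprn_ge0// mulr_ge0.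
by apply: lerXn2r; rewrite // nnegrE mulr_ge0//; lra.
Qed.

(** A term of the series is the difference of two consecutive remainders. *)
Lemma expansion_term_le h z0 a M z k : expansion h z0 a M ->
  z != z0 -> M * cabs (z - z0) <= 1 ->
  cabs (a k) * cabs (z - z0) ^+ k <= 2 * M * (M * cabs (z - z0)) ^+ k.
Proof.
move=> [M1 hM] zz0 zM.
have -> : cabs (a k) * cabs (z - z0) ^+ k =
    cabs ((h z - partial_sum a (z - z0) k) - (h z - partial_sum a (z - z0) k.+1)).
  by rewrite -cabsX -cabsM partial_sumS; congr cabs; ring.
apply: le_trans (cabsD _ _) _; rewrite cabsN.
have := hM z zz0 zM k; have := hM z zz0 zM k.+1.
have q0 : 0 <= M * cabs (z - z0) by rewrite mulr_ge0 ?cabs_ge0//; lra.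
have : M * (M * cabs (z - z0)) ^+ k.+1 <= M * (M * cabs (z - z0)) ^+ k.
  rewrite ler_wpM2l//; first lra.
  by rewrite exprS ler_piMl ?exprn_ge0.
lra.
Qed.

(** Cauchy's estimate, read off [expansion_term_le] on the circle of radius
    1/M. *)
Lemma expansion_coef_le h z0 a M k : expansion h z0 a M ->
  cabs (a k) <= 2 * M * M ^+ k.
Proof.
move=> hM; have M0 : 0 < M by case: hM => [M1 _]; lra.
pose z := z0 + (M^-1)%:C : C.
have zE : cabs (z - z0) = M^-1.
  by rewrite /z addrAC subrr add0r cabs_real// invr_ge0 ltW.
have zz0 : z != z0.
  by rewrite -subr_eq0 -cabs_eq0 zE invr_eq0 gt_eqF.
have := expansion_term_le k hM zz0.
rewrite zE divff ?gt_eqF// expr1n mulr1 exprVn => /(_ (lexx _)).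
by rewrite ler_pdivrMr ?exprn_gt0.
Qed.

Lemma analytic_cst (c z0 : C) : analytic_near (fun=> c) z0.
Proof.
pose M := 1 + cabs c; exists (fun k => if k is 0%N then c else 0), M.
have c0 := cabs_ge0 c.
split; first by rewrite /M; lra.
move=> z zz0 zM [|N].
  by rewrite /partial_sum big_ord0 subr0 expr0 mulr1 /M; lra.
rewrite /partial_sum big_ord_recl /= big1 ?addr0 => [|i _]; last by rewrite mul0r.
have := cabs_ge0 (z - z0) => w0.
rewrite expr0 mulr1 subrr cabs0 mulr_ge0 ?exprn_ge0 ?mulr_ge0// /M; lra.
Qed.

Lemma analytic_shift z0 : analytic_near (fun z => z - z0) z0.
Proof.
exists (fun k => (k == 1%N)%:R), 1; split=> // z zz0; rewrite mul1r => zM [|[|N]].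
- by rewrite /partial_sum big_ord0 subr0 expr0 mulr1.
- by rewrite /partial_sum big_ord1 mul0r subr0 mul1r expr1.
- rewrite /partial_sum 2!big_ord_recl /= big1 => [|i _]; last by rewrite mul0r.
  by rewrite !(mul0r, mul1r, add0r, addr0) expr1 subrr cabs0 exprn_ge0 ?cabs_ge0.
Qed.

Lemma analyticD h g z0 : analytic_near h z0 -> analytic_near g z0 ->
  analytic_near (fun z => h z + g z) z0.
Proof.
move=> [a [M1 hM1]] [b [M2 hM2]]; exists (fun k => a k + b k), (M1 + M2 + (M1 + M2)).
have [M11 _] := hM1; have [M21 _] := hM2.
have hM : expansion h z0 a (M1 + M2) by apply: expansion_weaken hM1; lra.
have {hM2}gM : expansion g z0 b (M1 + M2) by apply: expansion_weaken hM2; lra.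
move: hM gM; set M := M1 + M2 => -[_ hM] [_ gM].
have MN1 : 1 <= M by rewrite /M; lra.
split=> [|z zz0 zM N]; first by lra.
have w0 := cabs_ge0 (z - z0).
have zM1 : M * cabs (z - z0) <= 1.
  by apply: le_trans zM; rewrite ler_wpM2r//; lra.
have -> : h z + g z - partial_sum (fun k => a k + b k) (z - z0) N =
   (h z - partial_sum a (z - z0) N) + (g z - partial_sum b (z - z0) N).
  rewrite /partial_sum (eq_bigr _ (fun i _ => mulrDl _ _ _)) big_split /=; ring.
apply: le_trans (cabsD _ _) _.
have := hM z zz0 zM1 N; have := gM z zz0 zM1 N.
have : (M * cabs (z - z0)) ^+ N <= ((M + M) * cabs (z - z0)) ^+ N.
  apply: lerXn2r; rewrite ?nnegrE ?mulr_ge0//; [lra|lra|].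
  by rewrite ler_wpM2r//; lra.
move=> le1.
have : (M + M) * (M * cabs (z - z0)) ^+ N <= (M + M) * ((M + M) * cabs (z - z0)) ^+ N.
  by rewrite ler_wpM2l//; lra.
lra.
Qed.

Definition cauchy_coef a b k : C := \sum_(i < k.+1) a i * b (k - i)%N.

(** Grouping the terms of the Cauchy product by the first factor, the form in
    which its remainder can be compared to h g: it becomes
    (h - p_N) g + sum_(i < N) a_i w^i (g - q_(N - i)), p and q being the partial
    sums of the two factors. *)
Lemma cauchy_partial_sum a b w N : partial_sum (cauchy_coef a b) w N =
  \sum_(i < N) a i * w ^+ i * partial_sum b w (N - i).
Proof.
elim: N => [|N IH]; first by rewrite /partial_sum !big_ord0.
rewrite partial_sumS IH /cauchy_coef [X in X * _]big_ord_recr big_ord_recr /=.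
rewrite subnn subSnn /partial_sum big_ord1 expr0 mulr1 mulrDl addrA.
congr (_ + _); last by ring.
rewrite mulr_suml -big_split /=; apply: eq_bigr => i _.
have iN : (i <= N)%N by rewrite ltnW.
rewrite subSn// big_ord_recr /= mulrDr; congr (_ + _).
have -> : w ^+ N = w ^+ i * w ^+ (N - i) by rewrite -exprD subnKC.
by ring.
Qed.

(** With q = M|w| each of the N + 1 terms of the remainder of the Cauchy
    product is at most 2 M^2 q^N.  The factor N + 1 <= 2^N is absorbed by
    halving the radius, so that M can be replaced by 4 M^2. *)
Lemma analyticM h g z0 : analytic_near h z0 -> analytic_near g z0 ->
  analytic_near (fun z => h z * g z) z0.
Proof.
move=> [a [M1 hM1]] [b [M2 hM2]].
have [M11 _] := hM1; have [M21 _] := hM2.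
have hM : expansion h z0 a (M1 + M2) by apply: expansion_weaken hM1; lra.
have {hM2}gM : expansion g z0 b (M1 + M2) by apply: expansion_weaken hM2; lra.
have {hM1} := hM; have := gM.
move: hM gM; set M := M1 + M2 => hME gME [_ gM] [_ hM].
have MN1 : 1 <= M by rewrite /M; lra.
have MM1 : M <= M ^+ 2 by rewrite expr2 ler_peMl//; lra.
exists (cauchy_coef a b), (4 * M ^+ 2).
split=> [|z zz0 zM N]; first by lra.
have w0 := cabs_ge0 (z - z0).
pose q := M * cabs (z - z0).
have zM1 : q <= 1.
  by apply: le_trans zM; rewrite ler_wpM2r//; lra.
have q0 : 0 <= q by rewrite mulr_ge0//; lra.
rewrite cauchy_partial_sum; set w := z - z0 in w0 zM q zM1 q0 *.
have -> : h z * g z - \sum_(i < N) a i * w ^+ i * partial_sum b w (N - i) =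
   (h z - partial_sum a w N) * g z +
     \sum_(i < N) a i * w ^+ i * (g z - partial_sum b w (N - i)).
  under [X in _ = _ + X]eq_bigr do rewrite mulrBr.
  by rewrite sumrB -mulr_suml -/(partial_sum a w N); ring.
have qN0 : 0 <= q ^+ N by rewrite exprn_ge0.
have gz : cabs (g z) <= M.
  by have := gM z zz0 zM1 0%N; rewrite /partial_sum big_ord0 subr0 expr0 mulr1.
have le1 : cabs ((h z - partial_sum a w N) * g z) <= M ^+ 2 * q ^+ N.
  rewrite cabsM expr2 mulrAC; apply: ler_pM; rewrite ?cabs_ge0//.
  exact: hM.
have le2 : cabs (\sum_(i < N) a i * w ^+ i * (g z - partial_sum b w (N - i))) <=
    N%:R * (2 * M ^+ 2 * q ^+ N).
  apply: le_trans (cabs_sum _ _ _) _.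
  rewrite mulr_natl -[X in _ *+ X]card_ord -sumr_const; apply: ler_sum => i _.
  have iN : (i <= N)%N by rewrite ltnW.
  have -> : 2 * M ^+ 2 * q ^+ N = 2 * M * q ^+ i * (M * q ^+ (N - i)).
    have -> : q ^+ N = q ^+ i * q ^+ (N - i) by rewrite -exprD subnKC.
    by ring.
  rewrite 2!cabsM cabsX; apply: ler_pM; rewrite ?mulr_ge0 ?exprn_ge0 ?cabs_ge0//.
    exact: expansion_term_le hME zz0 zM1.
  exact: gM.
apply: le_trans (cabsD _ _) _.
have le3 : N.+1%:R * (2 * M ^+ 2 * q ^+ N) <= 2 ^+ N * (2 * M ^+ 2 * q ^+ N).
  by rewrite ler_wpM2r ?succn_le_exp2// !mulr_ge0// ?sqr_ge0; lra.
have le4 : (2 * q) ^+ N <= (4 * M ^+ 2 * cabs w) ^+ N.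
  apply: lerXn2r; rewrite ?nnegrE ?mulr_ge0//; try lra.
  by rewrite /q mulrA ler_wpM2r//; lra.
have M20 : 0 <= M ^+ 2 by lra.
have le5 : 2 * M ^+ 2 * (2 * q) ^+ N <= 4 * M ^+ 2 * (4 * M ^+ 2 * cabs w) ^+ N.
  apply: ler_pM => //.
  - by lra.
  - by apply: exprn_ge0; lra.
  - by lra.
have le6 : 0 <= M ^+ 2 * q ^+ N by rewrite mulr_ge0.
move: le3 le5; rewrite (exprMn N 2 q) -(natr1 N); lra.
Qed.

End Expansions.

(** * Sums of power series *)

Section Derivatives.
Local Open Scope complex_scope.
Variable R : realType.
Local Notation C := (Cplx R).
Implicit Types (h g : C -> C) (z w : C) (a b : nat -> C) (M : R).

(** A first-order Taylor bound with quadratic error, the only way in which a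
    derivative is computed from estimates below. *)
Lemma is_derive_quadratic h z (l : C) (Q r : R) : 0 < r -> 0 <= Q ->
  (forall d : C, d != 0 -> cabs d < r ->
     cabs (h (d + z) - h z - d * l) <= Q * cabs d ^+ 2) ->
  is_derive (z : C) (1 : C) (h : C -> C) l.
Proof.
move=> r0 Q0 hQ.
have cv : (fun d : C => d^-1 *: (h (d *: (1 : C) + z) - h z) : C) @ 0^' --> l.
  apply/cvgrPdist_lt => e e0.
  have [x ex] : exists x : R, e = x%:C.
    by exists (complex.Re (e : R[i])); rewrite RRe_real// gtr0_real.
  move: e0; rewrite ex (ltcR 0) => x0.
  apply/dnbhs_cabsP; exists (Num.min r (x / (Q + 1))).
    by rewrite lt_min r0 divr_gt0//; lra.
  move=> d d0; rewrite subr0 lt_min => /andP[dr]; rewrite ltr_pdivlMr; last lra.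
  move=> dx; rewrite cabs_lt -cabsN opprB.
  have cd0 : 0 < cabs d by rewrite cabs_gt0.
  rewrite -(ltr_pM2l cd0) -cabsM.
  have -> : d * (d^-1 *: (h (d *: (1 : C) + z) - h z) - l) =
      h (d + z) - h z - d * l.
    rewrite mulrBr -[d^-1 *: _]/(d^-1 * _) mulrA divff// mul1r.
    by rewrite -[d *: _]/(d * _) mulr1.
  apply: le_lt_trans (hQ d d0 dr) _.
  rewrite expr2 [Q * _]mulrCA ltr_pM2l//; lra.
have dh : derivable (h : C -> C) z (1 : C) by apply/cvg_ex; exists l.
exact: DeriveDef dh (cvg_lim _ cv).
Qed.

Lemma cplx_cvg_eventually (u : nat -> C) (l : C) (e : R) : 0 < e ->
  u @ \oo --> l -> exists n0, forall n, (n0 <= n)%N -> cabs (l - u n) < e.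
Proof.
move=> e0 /cvgrPdist_lt/(_ (e%:C)); rewrite (ltcR 0) => /(_ e0)[n0 _ nP].
by exists n0 => n n0n; rewrite -cabs_lt; exact: nP.
Qed.

Lemma partial_sum_tail_le a w (B q : R) : 0 <= B -> 0 <= q <= 1 / 2 ->
  (forall k, cabs (a k) * cabs w ^+ k <= B * q ^+ k) ->
  forall n m, (n <= m)%N ->
    cabs (partial_sum a w m - partial_sum a w n) <= 2 * B * q ^+ n.
Proof.
move=> B0 q2 aB n m nm.
have -> : partial_sum a w m - partial_sum a w n = \sum_(n <= k < m) a k * w ^+ k.
  rewrite /partial_sum -!(big_mkord xpredT (fun k => a k * w ^+ k)).
  by rewrite (big_cat_nat (leq0n n) nm) /= addrAC subrr add0r.
apply: le_trans (cabs_sum _ _ _) _.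
have := ler_wpM2l B0 (geometric_sum_le n m q2); rewrite mulrCA mulrA.
apply: le_trans; rewrite mulr_sumr; apply: ler_sum => k _.
by rewrite cabsM cabsX.
Qed.

(** At a point z1 at distance p = r/2 the terms of the series are bounded, by
    B say; closer to the centre the series is dominated by the geometric
    series of ratio |z - z0| / p. *)
Lemma analytic_power_series a g z0 :
  (\forall z \near z0^', [series a k * (z - z0) ^+ k]_k @ \oo --> g z) ->
  analytic_near g z0.
Proof.
move=> /dnbhs_cabsP[r r0 rP].
pose p := r / 2.
have p0 : 0 < p by rewrite divr_gt0.
have seriesE z n : [series a k * (z - z0) ^+ k]_k n = partial_sum a (z - z0) n.
  by rewrite seriesEord.
have [B B0 aB] : exists2 B : R, 0 <= B & forall k, cabs (a k) * p ^+ k <= B.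
  pose z1 := z0 + p%:C : C.
  have z1E : cabs (z1 - z0) = p by rewrite /z1 addrAC subrr add0r cabs_real// ltW.
  have z1N : z1 != z0 by rewrite -subr_eq0 -cabs_eq0 z1E gt_eqF.
  have z1r : cabs (z1 - z0) < r by rewrite z1E /p; lra.
  have [n0 nP] := cplx_cvg_eventually ltr01 (rP z1 z1N z1r).
  have s0 : 0 <= \sum_(k < n0) cabs (a k) * p ^+ k.
    by apply: sumr_ge0 => k _; rewrite mulr_ge0 ?cabs_ge0 ?exprn_ge0 ?ltW.
  exists (2 + \sum_(k < n0) cabs (a k) * p ^+ k) => [|k]; first lra.
  have [kn|nk] := ltnP k n0.
    rewrite (bigD1 (Ordinal kn))//= addrCA lerDl addr_ge0//.
    by apply: sumr_ge0 => j _; rewrite mulr_ge0 ?cabs_ge0 ?exprn_ge0 ?ltW.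
  have := nP k nk; have := nP k.+1 (leqW nk); rewrite !seriesE partial_sumS.
  set s := partial_sum _ _ _; set t := a k * _ => le1 le2.
  have -> : cabs (a k) * p ^+ k = cabs t by rewrite cabsM cabsX z1E.
  have -> : t = (g z1 - s) - (g z1 - (s + t)) by ring.
  have := cabsD (g z1 - s) (- (g z1 - (s + t))); rewrite cabsN; lra.
have ip0 : 0 < p^-1 by rewrite invr_gt0.
exists a, (1 + 2 * B + 2 * p^-1); split=> [|z zz0 zM N]; first lra.
have w0 := cabs_ge0 (z - z0); have wp : 0 < cabs (z - z0).
  by rewrite cabs_gt0 subr_eq0.
pose q := cabs (z - z0) * p^-1.
have q0 : 0 <= q by rewrite mulr_ge0// ltW.
have BW : 0 <= B * cabs (z - z0) by rewrite mulr_ge0.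
have q2 : q <= 1 / 2 by rewrite /q; lra.
have zr : cabs (z - z0) < r.
  have : cabs (z - z0) <= 1 / 2 * p by rewrite -ler_pdivrMr.
  by rewrite /p; lra.
have qq : 0 <= q <= 1 / 2 by rewrite q0.
have tail := partial_sum_tail_le (w := z - z0) (a := a) B0 qq.
have le1 : cabs (g z - partial_sum a (z - z0) N) <= 2 * B * q ^+ N.
  apply/ler_addgt0Pr => e e0.
  have [n0 nP] := cplx_cvg_eventually e0 (rP z zz0 zr).
  have := nP (maxn n0 N) (leq_maxl _ _); rewrite seriesE.
  have tl : cabs (partial_sum a (z - z0) (maxn n0 N) - partial_sum a (z - z0) N)
      <= 2 * B * q ^+ N.
    apply: tail; last exact: leq_maxr.
    move=> k; rewrite /q exprMn mulrA [leRHS]mulrAC.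
    rewrite ler_wpM2r ?exprn_ge0//.
    by rewrite exprVn ler_pdivlMr ?exprn_gt0.
  have := cabsD (g z - partial_sum a (z - z0) (maxn n0 N))
   (partial_sum a (z - z0) (maxn n0 N) - partial_sum a (z - z0) N).
  by rewrite addrA subrK; lra.
apply: le_trans le1 _; apply: ler_pM.
- lra.
- exact: exprn_ge0.
- lra.
apply: lerXn2r; rewrite ?nnegrE//.
  by apply: mulr_ge0 => //; lra.
by rewrite /q mulrC ler_wpM2r//; lra.
Qed.

Lemma analytic_congr h g z0 : (\forall z \near z0^', h z = g z) ->
  analytic_near h z0 -> analytic_near g z0.
Proof.
move=> /dnbhs_cabsP[r r0 rP] [a [M hM]].
have ir0 : 0 < r^-1 by rewrite invr_gt0.
exists a, (M + 2 * r^-1); have [M0 _] := hM.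
have [M1 {}hM] : expansion h z0 a (M + 2 * r^-1).
  by apply: expansion_weaken hM; lra.
split=> // z zz0 zM N; rewrite -rP//; first exact: hM.
have wp : 0 < cabs (z - z0) by rewrite cabs_gt0 subr_eq0.
have : cabs (z - z0) * r^-1 < 1.
  have : 1 * cabs (z - z0) <= (M + 2 * r^-1) * cabs (z - z0) by rewrite ler_wpM2r// ltW.
  have : r^-1 * cabs (z - z0) < (M + 2 * r^-1) * cabs (z - z0).
    by rewrite ltr_pM2r//; lra.
  lra.
by rewrite ltr_pdivrMr// mul1r.
Qed.

End Derivatives.

(** * Termwise differentiation *)

Section TermwiseDerivative.
Local Open Scope complex_scope.
Variable R : realType.
Local Notation C := (Cplx R).
Implicit Types (h g : C -> C) (z w d : C) (a b : nat -> C) (M : R).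

Lemma eq_ler (x y : R) : x = y -> x <= y.
Proof. by move=> ->. Qed.

(** The remainder r_k of the first-order Taylor formula for w^k satisfies
    r_(k+1) = (w + d) r_k + k w^(k-1) d^2, which gives the bound by induction;
    p bounds both points between which the increment is taken. *)
Lemma exp_taylor1_le w d (p : R) k : 0 < p -> cabs w <= p -> cabs (w + d) <= p ->
  cabs ((w + d) ^+ k - w ^+ k - d * (k%:R * w ^+ k.-1)) <=
    k%:R ^+ 2 * p ^+ k * (cabs d / p) ^+ 2.
Proof.
move=> p0 wp wdp; have pN0 : p != 0 by rewrite gt_eqF.
elim: k => [|k IH].
  by rewrite !expr0 subrr mul0r mulr0 subrr cabs0 expr0n /= !mul0r.
set T := (cabs d / p) ^+ 2 in IH *.
have T0 : 0 <= T by rewrite sqr_ge0.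
have pk0 : 0 <= p ^+ k * T by rewrite mulr_ge0// exprn_ge0// ltW.
have -> : (w + d) ^+ k.+1 - w ^+ k.+1 - d * (k.+1%:R * w ^+ k.+1.-1) =
    (w + d) * ((w + d) ^+ k - w ^+ k - d * (k%:R * w ^+ k.-1)) +
      k%:R * w ^+ k.-1 * d ^+ 2.
  have kw : k%:R * w ^+ k = w * (k%:R * w ^+ k.-1) :> C.
    by case: k {IH pk0} => [|k]; rewrite ?mul0r ?mulr0// exprS /=; ring.
  rewrite /= -(natr1 k) mulrDl kw !exprS; ring.
apply: le_trans (cabsD _ _) _.
have le1 : cabs (k%:R * w ^+ k.-1 * d ^+ 2) <= k%:R * (p * (p ^+ k * T)).
  rewrite 2!cabsM !cabsX cabs_nat -mulrA.
  case: k {IH pk0} => [|k]; first by rewrite !mul0r.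
  have -> : p * (p ^+ k.+1 * T) = p ^+ k * cabs d ^+ 2.
    by rewrite /T exprMn exprVn exprS; field.
  rewrite ler_wpM2l// ler_wpM2r ?sqr_ge0// lerXn2r ?nnegrE ?cabs_ge0//.
  exact: ltW.
have le2 : cabs ((w + d) * ((w + d) ^+ k - w ^+ k - d * (k%:R * w ^+ k.-1))) <=
    p * (k%:R ^+ 2 * (p ^+ k * T)).
  by rewrite cabsM; apply: ler_pM; rewrite ?cabs_ge0// [leRHS]mulrA.
have pT0 : 0 <= p * (p ^+ k * T) by rewrite mulr_ge0// ltW.
have kpT0 : 0 <= k%:R * (p * (p ^+ k * T)) by rewrite mulr_ge0.
apply: le_trans (lerD le2 le1) _.
have -> : k.+1%:R ^+ 2 * p ^+ k.+1 * T = p * (k%:R ^+ 2 * (p ^+ k * T)) +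
    k%:R * (p * (p ^+ k * T)) + (k%:R * (p * (p ^+ k * T)) + p * (p ^+ k * T)).
  by rewrite -(natr1 k) (exprS p k); ring.
by rewrite lerDl addr_ge0.
Qed.

Lemma nat_sqr_le_exp4 k : k%:R ^+ 2 <= 4 ^+ k :> R.
Proof.
have -> : 4 = 2 ^+ 2 :> R by ring.
rewrite -exprM mulnC exprM.
apply: lerXn2r; rewrite ?nnegrE ?exprn_ge0//.
by apply: le_trans (succn_le_exp2 _ k); rewrite ler_nat.
Qed.

Definition deriv_coef a k : C := k.+1%:R * a k.+1.

(** Taylor's formula for a partial sum with a constant independent of N.
    On the disc of radius 1/(8M) the k-th term contributes at most
    2M (8M|d|)^2 k^2 / 8^k, which k^2 <= 4^k makes geometric. *)
Lemma partial_sum_taylor1_le h z0 a M w d N : expansion h z0 a M ->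
  cabs w <= (8 * M)^-1 -> cabs (w + d) <= (8 * M)^-1 ->
  cabs (partial_sum a (w + d) N.+1 - partial_sum a w N.+1
          - d * partial_sum (deriv_coef a) w N) <= 256 * M ^+ 3 * cabs d ^+ 2.
Proof.
move=> hM wM wdM; have M1 : 1 <= M by case: hM.
have -> : partial_sum (deriv_coef a) w N =
    \sum_(k < N.+1) a k * (k%:R * w ^+ k.-1).
  rewrite big_ord_recl /= mul0r mulr0 add0r; apply: eq_bigr => i _.
  by rewrite /bump /= add1n /deriv_coef /= [RHS]mulrCA mulrA.
rewrite /partial_sum mulr_sumr -!sumrB.
apply: le_trans (cabs_sum _ _ _) _.
pose D : R := 2 * M * (8 * M * cabs d) ^+ 2.
have D0 : 0 <= D by rewrite mulr_ge0 ?sqr_ge0//; lra.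
apply: (@le_trans _ _ (\sum_(0 <= k < N.+1) D * (1 / 2) ^+ k)).
  rewrite big_mkord; apply: ler_sum => k _.
  have -> : a k * (w + d) ^+ k - a k * w ^+ k - d * (a k * (k%:R * w ^+ k.-1)) =
      a k * ((w + d) ^+ k - w ^+ k - d * (k%:R * w ^+ k.-1)) by ring.
  have p0 : 0 < (8 * M)^-1 by rewrite invr_gt0; lra.
  have le1 := exp_taylor1_le k p0 wM wdM.
  have le2 := expansion_coef_le k hM.
  rewrite cabsM.
  apply: le_trans (ler_pM (cabs_ge0 _) (cabs_ge0 _) le2 le1) _.
  rewrite invrK -[leLHS]/(_ * _ * (_ * _ * _)).
  have -> : 2 * M * M ^+ k * (k%:R ^+ 2 * (8 * M)^-1 ^+ k * (cabs d * (8 * M)) ^+ 2)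
     = D * (k%:R ^+ 2 * (M ^+ k * (8 * M)^-1 ^+ k)) by rewrite /D; ring.
  rewrite ler_wpM2l// -exprMn.
  have -> : M * (8 * M)^-1 = 1 / 8 by field; lra.
  apply: le_trans (ler_wpM2r _ (nat_sqr_le_exp4 k)) _.
    by rewrite exprn_ge0.
  rewrite -exprMn; apply: lerXn2r; rewrite ?nnegrE; lra.
rewrite -mulr_sumr.
have half : (0 <= (1 / 2 : R) <= 1 / 2). by apply/andP; split; lra.
apply: le_trans (ler_wpM2l D0 (geometric_sum_le 0 _ half)) _.
by apply: eq_ler; rewrite /D expr0; ring.
Qed.

(** The partial sums of the termwise derivative converge geometrically, which
    defines g.  Letting N grow in [partial_sum_taylor1_le] shows that g is the
    derivative of h.  The radius 1/(16 M^2) keeps |z - z0| below 1/(16M), hence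
    both z and the nearby point z + d inside the disc of radius 1/(8M). *)
Lemma analytic_derive h z0 : analytic_near h z0 -> exists g : C -> C,
  analytic_near g z0 /\
  \forall z \near z0^', is_derive (z : C) (1 : C) (h : C -> C) (g z).
Proof.
move=> [a [M hME]]; have [M1 hM] := hME.
have M0 : 0 < M by lra.
have MM1 : M <= M ^+ 2 by rewrite expr2 ler_peMl// ltW.
have M20 : 0 <= 8 * M ^+ 2 by lra.
have small16 (x : R) : 0 <= x -> 16 * x <= 1 ->
    [/\ x <= 1, x <= 1 / 2, 0 <= 2 * x, 2 * x <= 1 / 2 & 8 * x <= 1].
  by move=> ? ?; split; lra.
have small8 (x y u : R) : 16 * x <= 1 -> 16 * y <= 1 -> u <= x + y ->
    [/\ u <= 1, u <= 1 / 2 & 8 * u <= 1].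
  by move=> ? ? ?; split; lra.
have small x : 8 * (M * x) <= 1 -> x <= (8 * M)^-1.
  by move=> xM; rewrite -[_^-1]mul1r ler_pdivlMr; lra.
pose good z := z != z0 /\ 16 * M ^+ 2 * cabs (z - z0) <= 1.
have goodM z : good z -> 16 * (M * cabs (z - z0)) <= 1.
  move=> [_]; apply: le_trans; rewrite mulrA ler_wpM2r ?cabs_ge0//; lra.
have /choice[g gP] : forall z, exists y : C, good z -> forall N,
    cabs (y - partial_sum (deriv_coef a) (z - z0) N) <=
      8 * M ^+ 2 * (2 * (M * cabs (z - z0))) ^+ N.
  move=> z; have [gz|] := pselect (good z); last by exists 0.
  have q1 := goodM _ gz; set q := M * cabs (z - z0) in q1 *.
  have q0 : 0 <= q by rewrite mulr_ge0 ?cabs_ge0 ?ltW.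
  have B0 : 0 <= 2 * M ^+ 2 by lra.
  have qq : 0 <= 2 * q <= 1 / 2 by apply/andP; split; lra.
  have [k|y yP] := cplx_limit_with_rate (partial_sum_tail_le
      (a := deriv_coef a) (w := z - z0) B0 qq _); last first.
    by exists y => _ N; apply: le_trans (yP N) _; apply: eq_ler; ring.
  rewrite /deriv_coef cabsM cabs_nat exprMn.
  have le1 := expansion_coef_le k.+1 hME.
  have le2 := succn_le_exp2 R k.
  have wk0 : 0 <= cabs (z - z0) ^+ k by rewrite exprn_ge0 ?cabs_ge0.
  apply: le_trans (ler_wpM2r wk0 (ler_pM _ _ le2 le1)) _; rewrite ?cabs_ge0//.
  by apply: eq_ler; rewrite /q !exprMn !exprS; ring.
exists g; split.
  exists (deriv_coef a), (16 * M ^+ 2); split=> [|z zz0 zM N]; first lra.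
  apply: le_trans (gP z (conj zz0 zM) N) _.
  have c0 := cabs_ge0 (z - z0).
  have q0 : 0 <= M * cabs (z - z0) by rewrite mulr_ge0//; lra.
  apply: ler_pM; [lra|apply: exprn_ge0; lra|lra|].
  apply: lerXn2r; rewrite ?nnegrE; [lra|rewrite mulr_ge0//; lra|].
  by rewrite mulrA ler_wpM2r//; lra.
apply/dnbhs_cabsP; exists (16 * M ^+ 2)^-1; first by rewrite invr_gt0; lra.
move=> z zz0 zr.
have zM : 16 * M ^+ 2 * cabs (z - z0) <= 1.
  by rewrite mulrC -ler_pdivlMr ?div1r ?ltW//; lra.
have gz : good z by [].
have q1 := goodM _ gz; set w := z - z0 in zM q1 *.
have w0 : 0 < cabs w by rewrite cabs_gt0 subr_eq0.
have q0 : 0 <= M * cabs w by rewrite mulr_ge0 ?cabs_ge0 ?ltW.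
apply: (@is_derive_quadratic _ _ _ _ (256 * M ^+ 3)
          (Num.min (cabs w) (16 * M)^-1)).
- by rewrite lt_min w0 invr_gt0 mulr_gt0.
- by rewrite mulr_ge0 ?ler0n ?exprn_ge0 ?ltW.
move=> d d0; rewrite lt_min => /andP[dw dM].
have dq : 16 * (M * cabs d) <= 1.
  by rewrite mulrA mulrC -ler_pdivlMr ?div1r ?ltW ?mulr_gt0.
have dq0 : 0 <= M * cabs d by rewrite mulr_ge0 ?cabs_ge0 ?ltW.
have wd : d + z - z0 = w + d by rewrite /w; ring.
have dz : d + z != z0.
  rewrite -subr_eq0 wd addr_eq0; apply/eqP => wdE.
  by move: dw; rewrite wdE cabsN ltxx.
have cwd := cabsD w d.
have Mcwd : M * cabs (w + d) <= M * cabs w + M * cabs d.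
  by rewrite -mulrDr ler_wpM2l// ltW.
have Mwd0 : 0 <= M * cabs (w + d) by rewrite mulr_ge0 ?cabs_ge0 ?ltW.
have tl N := partial_sum_taylor1_le (d := d) (w := w) N hME.
apply: (@ler_add_geometric _ _ _ (2 * M + cabs d * (8 * M ^+ 2)) (1 / 2)).
  by lra.
move=> N.
have h1 := hM (d + z) dz; rewrite wd in h1.
have {}h1 := h1 _ N.+1; have h2 := hM z zz0 _ N.+1.
(* All errors but the quadratic one are O(2^-N). *)
have [w1 w2 w3 w4 w8] := small16 _ q0 q1.
have [wd1 wd2 wd8] := small8 _ _ _ q1 dq Mcwd.
have {}h1 := h1 wd1; have {}h2 := h2 w1.
have {}tl := tl N (small _ w8) (small _ wd8).
have h3 := gP z gz N; rewrite -/w in h2 h3.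
have halfN (q : R) : 0 <= q -> q <= 1 / 2 -> q ^+ N <= (1 / 2) ^+ N.
  by move=> q00 q12; apply: lerXn2r; rewrite ?nnegrE// (le_trans q00).
have halfN1 (q : R) : 0 <= q -> q <= 1 / 2 -> M * q ^+ N.+1 <= M * (1 / 2) ^+ N.
  move=> q00 q12; apply: ler_wpM2l; first exact: ltW.
  rewrite (exprS q N).
  apply: (le_trans _ (halfN q q00 q12)).
  rewrite ler_piMl ?exprn_ge0// (le_trans q12)//.
  by rewrite ler_pdivrMr// mul1r ler1n.
have k1 := halfN1 _ Mwd0 wd2.
have k2 := halfN1 _ q0 w2.
have k3 := halfN (2 * (M * cabs w)) w3 w4.
have k4 : cabs d * (8 * M ^+ 2 * (2 * (M * cabs w)) ^+ N) <=
    cabs d * (8 * M ^+ 2) * (1 / 2) ^+ N.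
  rewrite -[leRHS]mulrA; apply: ler_wpM2l; first exact: cabs_ge0.
  exact: ler_wpM2l.
have k5 := ler_wpM2l (cabs_ge0 d) h3; rewrite -cabsM in k5.
set s1 := partial_sum a (w + d) N.+1 in tl h1.
set s2 := partial_sum a w N.+1 in tl h2.
set s3 := partial_sum _ w N in tl k5.
have -> : h (d + z) - h z - d * g z = (h (d + z) - s1) - (h z - s2)
   + (s1 - s2 - d * s3) - d * (g z - s3) by ring.
have e1 := cabsD (h (d + z) - s1) (- (h z - s2)).
have e2 := cabsD ((h (d + z) - s1) - (h z - s2)) (s1 - s2 - d * s3).
have e3 := cabsD ((h (d + z) - s1) - (h z - s2) + (s1 - s2 - d * s3))
  (- (d * (g z - s3))).
rewrite !cabsN in e1 e2 e3.
apply: le_trans e3 _; apply: le_trans (lerD (le_trans e2 (lerD e1 (lexx _))) k5) _.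
apply: le_trans (lerD (lerD (lerD (le_trans h1 k1) (le_trans h2 k2)) tl) k4) _.
by apply: eq_ler; ring.
Qed.

End TermwiseDerivative.

(** * Laurent expansions and the identity theorem *)

Definition has_deriv (R : realType) (f : Cplx R -> Cplx R) (z l : Cplx R) :=
  is_derive (z : Cplx R) (1 : Cplx R) (f : Cplx R -> Cplx R) l.

Section DerivRules.
Variable R : realType.
Local Notation C := (Cplx R).
Implicit Types (f g : C -> C) (z l : C).

Lemma has_deriv_derive1 f z l : has_deriv f z l -> derive1 f z = l.
Proof. by move=> [_ <-]; rewrite derive1E. Qed.

Lemma has_deriv_cst (c z : C) : has_deriv (fun=> c) z 0.
Proof. exact: is_derive_cst. Qed.

Lemma has_deriv_shift (z0 z : C) : has_deriv (fun y => y - z0) z 1.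
Proof.
have H := is_deriveB (is_derive_id (z : C) (1 : C)) (is_derive_cst z0 (z : C) (1 : C)).
by rewrite subr0 in H; exact: H.
Qed.

Lemma has_derivD f g z l k : has_deriv f z l -> has_deriv g z k ->
  has_deriv (fun y => f y + g y) z (l + k).
Proof. by move=> fl gk; have := is_deriveD fl gk. Qed.

Lemma has_derivM f g z l k : has_deriv f z l -> has_deriv g z k ->
  has_deriv (fun y => f y * g y) z (f z * k + l * g z).
Proof. by move=> fl gk; rewrite [l * _]mulrC; have := is_deriveM fl gk. Qed.

Lemma has_derivV f z l : f z != 0 -> has_deriv f z l ->
  has_deriv (fun y => (f y)^-1) z (- (f z)^-1 ^+ 2 * l).
Proof.
move=> fz [df <-]; apply: DeriveDef; first exact: derivableV.
by rewrite deriveV// exprVn.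
Qed.

Lemma has_deriv_near f g z l : (\forall y \near z, f y = g y) ->
  has_deriv f z l -> has_deriv g z l.
Proof. exact: near_eq_is_derive. Qed.

Lemma has_derivX f z l n : has_deriv f z l ->
  has_deriv (fun y => f y ^+ n) z (n%:R * f z ^+ n.-1 * l).
Proof.
by move=> fl; have := is_deriveX n fl; rewrite exprfctE.
Qed.

(** A punctured disc is open, so a property that holds on it holds near each of
    its points: this is what makes the derivative depend only on the class of a
    function for [mero_eq]. *)
Lemma near_dnbhs_near (z0 : C) (P : C -> Prop) : (\forall z \near z0^', P z) ->
  \forall z \near z0^', \forall y \near z, P y.
Proof.
move=> /dnbhs_cabsP[r r0 rP]; apply/dnbhs_cabsP; exists r => // z zz0 zr.
have w0 : 0 < cabs (z - z0) by rewrite cabs_gt0 subr_eq0.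
apply/nbhs_cabsP; exists (Num.min (cabs (z - z0)) (r - cabs (z - z0))).
  by rewrite lt_min w0 subr_gt0.
move=> y; rewrite lt_min => /andP[yw yr]; apply: rP.
  by apply: contraTneq yw => ->; rewrite cabsB ltxx.
have -> : y - z0 = (y - z) + (z - z0) by ring.
by apply: le_lt_trans (cabsD _ _) _; rewrite -ltrBrDr.
Qed.

Lemma derive1_mero_eq f g : mero_eq f g -> mero_eq (derive1 f) (derive1 g).
Proof.
move=> fg z0; apply: filterS (near_dnbhs_near (fg z0)) => z.
by move=> zfg; rewrite !derive1E; exact: near_eq_derive.
Qed.

End DerivRules.

Section Laurent.
Local Open Scope complex_scope.
Variable R : realType.
Local Notation C := (Cplx R).
Implicit Types (f g h : C -> C) (z : C).

(** The analogue of [meromorphic_at] for [analytic_near]. *)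
Definition laurent_near f z0 :=
  exists N, analytic_near (fun z => (z - z0) ^+ N * f z) z0.

Lemma meromorphic_laurent f z0 : meromorphic_at f z0 -> laurent_near f z0.
Proof. by move=> [N [a fa]]; exists N; exact: analytic_power_series fa. Qed.

Lemma analytic_shiftX z0 N : analytic_near (fun z : C => (z - z0) ^+ N) z0.
Proof.
elim: N => [|N IH]; first exact: analytic_cst.
have := analyticM (analytic_shift z0) IH.
by apply: analytic_congr; apply: nearW => z; rewrite exprS.
Qed.

Lemma laurent_cst (c z0 : C) : laurent_near (fun=> c) z0.
Proof.
by exists 0%N; apply: analyticM; [exact: analytic_shiftX|exact: analytic_cst].
Qed.

Lemma laurentD f g z0 : laurent_near f z0 -> laurent_near g z0 ->
  laurent_near (fun z => f z + g z) z0.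
Proof.
move=> [N fN] [K gK]; exists (N + K)%N.
have := analyticD (analyticM (analytic_shiftX z0 K) fN)
                  (analyticM (analytic_shiftX z0 N) gK).
by apply: analytic_congr; apply: nearW => z; rewrite exprD; ring.
Qed.

Lemma laurentM f g z0 : laurent_near f z0 -> laurent_near g z0 ->
  laurent_near (fun z => f z * g z) z0.
Proof.
move=> [N fN] [K gK]; exists (N + K)%N.
have := analyticM fN gK.
by apply: analytic_congr; apply: nearW => z; rewrite exprD; ring.
Qed.

(** If w^N f = h is analytic then w^(N+1) f' = w h' - N h. *)
Lemma laurent_derive1 f z0 : laurent_near f z0 ->
  (\forall z \near z0^', has_deriv f z (derive1 f z)) /\
  laurent_near (derive1 f) z0.
Proof.
move=> [N fN]; have [g [gan gd]] := analytic_derive fN.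
have df : \forall z \near z0^', has_deriv f z (derive1 f z).
  have nz : \forall z \near z0^', z - z0 != 0.
    by apply/dnbhs_cabsP; exists 1 => // z; rewrite subr_eq0.
  apply: filterS2 (near_dnbhs_near nz) gd => z nzz gdz.
  have wN : (z - z0) ^+ N != 0 by rewrite expf_neq0// (nbhs_singleton nzz).
  have d1 := @has_derivV _ (fun y => (y - z0) ^+ N) z _ wN
               (has_derivX N (has_deriv_shift z0 z)).
  have {}d1 := has_derivM d1 gdz.
  have E : \forall y \near z, ((y - z0) ^+ N)^-1 * ((y - z0) ^+ N * f y) = f y.
    by apply: filterS nzz => y y0; rewrite mulKf// expf_neq0.
  by have d2 := has_deriv_near E d1; rewrite (has_deriv_derive1 d2).
split=> //; exists N.+1.
have := analyticD (analyticM (analytic_shift z0) gan)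
          (analyticM (analytic_cst (- N%:R : C) z0) fN).
apply: analytic_congr; apply: filterS2 gd df => z gdz dfz.
have := has_derivM (has_derivX N (has_deriv_shift z0 z)) dfz.
move=> /has_deriv_derive1; rewrite (has_deriv_derive1 gdz) => ->.
case: N {fN gan gdz} => [|N]; rewrite ?exprS /= ?expr0; ring.
Qed.

(** If all coefficients vanish, so does h by its remainders; otherwise the first
    nonzero term a_m w^m dominates the next remainder near the centre. *)
Lemma analytic_zero_isolated h z0 : analytic_near h z0 ->
  (\forall z \near z0^', h z = 0) \/ (\forall z \near z0^', h z != 0).
Proof.
move=> [a [M [M1 hM]]]; have M0 : 0 < M by lra.
have [a0|/existsNP[n0 /eqP an0]] := pselect (forall k, a k = 0).
  left; apply/dnbhs_cabsP; exists (2 * M)^-1; first by rewrite invr_gt0 mulr_gt0.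
  move=> z zz0; rewrite -div1r ltr_pdivlMr ?mulr_gt0// => zM.
  have q0 : 0 <= M * cabs (z - z0) by rewrite mulr_ge0 ?cabs_ge0 ?ltW.
  apply/eqP; rewrite -cabs_eq0 eq_le cabs_ge0 andbT.
  have qq : 0 <= M * cabs (z - z0) <= 1 / 2 by apply/andP; split; lra.
  apply: (ler_add_geometric (c := M) qq) => N; rewrite add0r.
  have := hM z zz0 _ N; rewrite /partial_sum big1 ?subr0; last first.
    by move=> i _; rewrite a0 mul0r.
  by apply; lra.
have exn : exists n, a n != 0 by exists n0.
pose m := ex_minn exn.
have am : a m != 0 by rewrite /m; case: ex_minnP.
have alt k : (k < m)%N -> a k = 0.
  rewrite /m; case: ex_minnP => n _ nmin kn; apply: contraTeq kn => ak.
  by rewrite -leqNgt nmin.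
have cam : 0 < cabs (a m) by rewrite cabs_gt0.
right; apply/dnbhs_cabsP.
exists (Num.min M^-1 (cabs (a m) / (M * M ^+ m.+1))).
  by rewrite lt_min invr_gt0 M0 divr_gt0// mulr_gt0// exprn_gt0.
move=> z zz0; rewrite lt_min ltr_pdivlMr ?mulr_gt0 ?exprn_gt0// => /andP[zM zam].
have w0 : 0 < cabs (z - z0) by rewrite cabs_gt0 subr_eq0.
have zM1 : M * cabs (z - z0) <= 1.
  by rewrite mulrC -ler_pdivlMr// div1r ltW.
have := hM z zz0 zM1 m.+1; rewrite partial_sumS /partial_sum big1 => [|i _]; last first.
  by rewrite alt ?mul0r.
rewrite add0r => le1; apply/eqP => hz; move: le1.
rewrite hz sub0r cabsN cabsM cabsX leNgt => /negP; apply.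
have -> : M * (M * cabs (z - z0)) ^+ m.+1 =
    cabs (z - z0) * (M * M ^+ m.+1) * cabs (z - z0) ^+ m.
  by rewrite exprMn (exprS (cabs (z - z0)) m); ring.
by rewrite ltr_pM2r// exprn_gt0.
Qed.

Lemma laurent_zero_isolated f z0 : laurent_near f z0 ->
  (\forall z \near z0^', f z = 0) \/ (\forall z \near z0^', f z != 0).
Proof.
move=> [N /analytic_zero_isolated fN].
have nz : \forall z \near z0^', z - z0 != 0.
  by apply/dnbhs_cabsP; exists 1 => // z; rewrite subr_eq0.
case: fN => fN; [left|right]; apply: filterS2 nz fN => z wz.
  by move=> /eqP; rewrite mulf_eq0 expf_eq0 (negbTE wz) andbF => /eqP.
by rewrite mulf_eq0 negb_or => /andP[].
Qed.

(** C is not the union of two disjoint nonempty open sets: along the segment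
    from z1 to z2 these would disconnect the real line. *)
Lemma cplx_connected (A B : C -> Prop) :
  (forall z, A z -> \forall y \near z, A y) ->
  (forall z, B z -> \forall y \near z, B y) ->
  (forall z, A z \/ B z) -> (forall z, A z -> ~ B z) ->
  forall z1 z2, A z1 -> A z2.
Proof.
move=> Ao Bo AB AnB z1 z2 Az1.
pose path (t : R) : C := z1 + t%:C * (z2 - z1).
have path_open (P : C -> Prop) : (forall z, P z -> \forall y \near z, P y) ->
    open [set t | P (path t)].
  move=> Po; rewrite openE => t /Po /nbhs_cabsP[r r0 rP].
  have c0 := cabs_ge0 (z2 - z1).
  have s0 : 0 < r / (cabs (z2 - z1) + 1) by rewrite divr_gt0//; lra.
  apply/nbhs_ballP; exists (r / (cabs (z2 - z1) + 1)) => //= s.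
  rewrite -ball_normE /= ltr_pdivlMr; last lra.
  move=> ts; apply: rP.
  have -> : path s - path t = (s - t)%:C * (z2 - z1) by rewrite rmorphB /path /=; ring.
  have -> : cabs ((s - t)%:C * (z2 - z1)) = `|t - s| * cabs (z2 - z1).
    rewrite cabsM distrC; congr (_ * _); apply: complexI; rewrite -normr_cabs.
    by rewrite normc_def /= expr0n /= addr0 sqrtr_sqr.
  by have := normr_ge0 (t - s); lra.
have p0 : path 0 = z1 by rewrite /path rmorph0 mul0r addr0.
have p1 : path 1 = z2 by rewrite /path rmorph1 mul1r addrC subrK.
have conn : connected [set: R] by apply/connected_intervalP.
suff -> : A z2 = [set: R] 1 by [].
rewrite -p1 -[A _]/([set t | A (path t)] 1); congr (_ 1); apply: conn.
- by exists 0; rewrite /= p0.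
- by exists [set t | A (path t)]; [exact: path_open|rewrite setTI].
- exists (~` [set t | B (path t)]); first exact/open_closedC/path_open.
  rewrite setTI; apply/seteqP; split=> t /=; first exact: AnB.
  by move=> nB; case: (AB (path t)).
Qed.

Lemma near_dnbhs_open (P : C -> Prop) z : (\forall y \near z^', P y) ->
  \forall y \near z, \forall x \near y^', P x.
Proof.
move=> Pz.
have /= [r r0 rP] :=
  (dnbhs_cabsP z (fun y => \forall x \near y, P x)).1 (near_dnbhs_near Pz).
apply: (nbhs_cabsP z (fun y => \forall x \near y^', P x)).2.
exists r; first exact: r0.
move=> y yr.
have [->|yz] := eqVneq y z; first exact: Pz.
have [s s0 sP] := (nbhs_cabsP y P).1 (rP y yz yr).
by apply: (dnbhs_cabsP y P).2; exists s => // x _; exact: sP.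
Qed.

(** The points around which f vanishes and those around which it has no zero
    form two disjoint open sets, which cover C because zeros are isolated. *)
Lemma identity_theorem f : (forall z, laurent_near f z) ->
  mero_eq f (fun=> 0) \/ forall z0, \forall z \near z0^', f z != 0.
Proof.
move=> fl.
have [f0|/existsNP[z1 nz1]] := pselect (mero_eq f (fun=> 0)); first by left.
right=> z2; have [/nz1[]|fz1] := laurent_zero_isolated (fl z1).
pose A z := \forall y \near z^', f y != 0.
pose B z := \forall y \near z^', f y = 0.
refine (@cplx_connected A B _ _ _ _ z1 z2 fz1) => z.
- exact: near_dnbhs_open.
- exact: near_dnbhs_open.
- by have [fz|fz] := laurent_zero_isolated (fl z); [right|left].
- by move=> fz0 fz; have [y [/eqP ? ?]] := filter_ex (filterI fz0 fz).
Qed.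

End Laurent.

(** * Algebras of functions stable under derivation *)

Section MpolyDeriv.
Variables (K : numFieldType) (n : nat).
Implicit Types (P : mpoly n K) (i : 'I_n).

(** In characteristic 0, a polynomial with zero derivative in a variable does
    not involve this variable. *)
Lemma mderiv_eq0_exponent P i m : mderiv i P = 0 -> m \in msupp P -> m i = 0%N.
Proof.
move=> Pi0 mP; apply: contraTeq mP => mi0.
have U_le : lem (mnm1 i) m.
  by apply/mnm_lepP => j; rewrite mnm1E; case: eqP => // <-; rewrite lt0n.
have := mcoeff_deriv i (mnm_sub m (mnm1 i)) P.
rewrite Pi0 mcoeff0 submK// => /esym/eqP.
by rewrite mulrn_eq0 /= => /eqP; rewrite -mcoeff_eq0 => ->.
Qed.

Lemma msize_mderiv_lt P i : P != 0 -> (msize (mderiv i P) < msize P)%N.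
Proof.
move=> P0; have : (0 < msize P)%N by rewrite lt0n msize_poly_eq0.
case: (msize P) (@msize_mdeg_lt _ _ P) => // s sP _; rewrite ltnS msizeE.
apply/bigmax_leqP_seq => m; rewrite mcoeff_msupp mcoeff_deriv => mP _.
have /sP : mnm_add m (mnm1 i) \in msupp P.
  by rewrite mcoeff_msupp; apply: contraNneq mP => ->; rewrite mul0rn.
by rewrite mdegD mdeg1 addn1 ltnS.
Qed.

Lemma nonconstant_mderiv P : (1 < msize P)%N -> exists i, mderiv i P != 0.
Proof.
move=> P1; apply/existsP; apply: contraLR P1; rewrite negb_exists => /forallP d0.
rewrite -leqNgt msizeE; apply/bigmax_leqP_seq => m mP _.
rewrite ltnS leqn0 mdeg_eq0; apply/eqP/mnmP => i; rewrite mnm0E.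
by apply: mderiv_eq0_exponent mP; apply/eqP; have := d0 i; rewrite negbK.
Qed.

End MpolyDeriv.

Section Generated.
Variable R : realType.
Local Notation C := (Cplx R).
Implicit Types (f g u : C -> C) (S T : set (C -> C)).

(** Differentiability away from a closed discrete set, the notion that is
    invariant under [mero_eq]; [derive1] has a meaningful value there. *)
Definition smooth f := forall z0 : C, \forall z \near z0^', has_deriv f z (derive1 f z).

(** The C-algebra generated by S, as a set of functions saturated for
    [mero_eq]: its elements are polynomials in elements of S up to
    [mero_eq]. *)
Inductive generated S : (C -> C) -> Prop :=
| generated_mem f : S f -> generated S f
| generated_cst (c : C) : generated S (fun=> c)
| generatedD f g : generated S f -> generated S g ->
    generated S (fun z => f z + g z)
| generatedM f g : generated S f -> generated S g ->
    generated S (fun z => f z * g z)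
| generated_eq f g : mero_eq f g -> generated S f -> generated S g.

Lemma mero_eqS f g : mero_eq f g -> mero_eq g f.
Proof. by move=> fg z0; apply: filterS (fg z0). Qed.

Lemma smooth_eq f g : mero_eq f g -> smooth f -> smooth g.
Proof.
move=> fg sf z0; apply: filterS2 (near_dnbhs_near (fg z0)) (sf z0) => z zfg fz.
by have gz := has_deriv_near zfg fz; rewrite (has_deriv_derive1 gz).
Qed.

Lemma generated_mono S T f : S `<=` T -> generated S f -> generated T f.
Proof.
move=> ST; elim=> {f} [f /ST| | | |].
- exact: generated_mem.
- exact: generated_cst.
- by move=> f g _ ? _ ?; exact: generatedD.
- by move=> f g _ ? _ ?; exact: generatedM.
- by move=> f g fg _; exact: generated_eq.
Qed.

(** Leibniz' rule.  The algebra that receives the derivatives is distinguished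
    from the one where f lives, in order to differentiate the separant in the
    algebra generated by f, ..., f^(k) before the larger algebra is known to be
    stable under derivation. *)
Lemma generated_derive1 S T f : T `<=` S ->
  (forall u, T u -> smooth u /\ generated S (derive1 u)) ->
  generated T f -> smooth f /\ generated S (derive1 f).
Proof.
move=> TS Td; elim=> {f} [f /Td//|c|f g Tf [fs fd] Tg [gs gd]|f g Tf [fs fd] Tg [gs gd]|
  f g fg Tf [fs fd]].
- have d z : has_deriv (fun=> c : C) z 0 by exact: has_deriv_cst.
  split=> [z0|]; first by apply: nearW => z; rewrite (has_deriv_derive1 (d z)).
  apply: generated_eq (generated_cst S 0) => z0.
  by apply: nearW => z; rewrite (has_deriv_derive1 (d z)).
- split=> [z0|].
    apply: filterS2 (fs z0) (gs z0) => z fz gz.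
    by have d := has_derivD fz gz; rewrite (has_deriv_derive1 d).
  apply: generated_eq (generatedD fd gd) => z0.
  apply: filterS2 (fs z0) (gs z0) => z fz gz.
  by have d := has_derivD fz gz; rewrite (has_deriv_derive1 d).
- split=> [z0|].
    apply: filterS2 (fs z0) (gs z0) => z fz gz.
    by have d := has_derivM fz gz; rewrite (has_deriv_derive1 d).
  apply: (@generated_eq _ (fun z => f z * derive1 g z + derive1 f z * g z)).
    move=> z0; apply: filterS2 (fs z0) (gs z0) => z fz gz.
    by have d := has_derivM fz gz; rewrite (has_deriv_derive1 d).
  by apply: generatedD; apply: generatedM => //; exact: generated_mono TS _.
- split; first exact: smooth_eq fs.
  exact: generated_eq (derive1_mero_eq fg) fd.
Qed.

Definition diff_closed S :=
  forall u, S u -> smooth u /\ generated S (derive1 u).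

Lemma diff_closed_derive1n S f k : diff_closed S -> generated S f ->
  generated S (derive1n k f).
Proof.
move=> Sc Sf; elim: k => [//|k IH].
by have [_] := generated_derive1 (@subset_refl _ S) Sc IH.
Qed.

Lemma generated_sum S (I : eqType) (r : seq I) (F : I -> C -> C) :
  (forall i, i \in r -> generated S (F i)) ->
  generated S (fun z => \sum_(i <- r) F i z).
Proof.
elim: r => [_|i r IH rF].
  by apply: generated_eq (generated_cst S 0) => z0; apply: nearW => z; rewrite big_nil.
apply: (@generated_eq _ (fun z => F i z + \sum_(i <- r) F i z)).
  by move=> z0; apply: nearW => z; rewrite big_cons.
apply: generatedD; first by apply: rF; rewrite mem_head.
by apply: IH => k kr; apply: rF; rewrite inE kr orbT.
Qed.

Lemma generated_prod S (I : Type) (r : seq I) (F : I -> C -> C) :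
  (forall i, generated S (F i)) ->
  generated S (fun z => \prod_(i <- r) F i z).
Proof.
move=> rF; elim: r => [|i r IH].
  by apply: generated_eq (generated_cst S 1) => z0; apply: nearW => z; rewrite big_nil.
apply: (@generated_eq _ (fun z => F i z * \prod_(i <- r) F i z)).
  by move=> z0; apply: nearW => z; rewrite big_cons.
exact: generatedM.
Qed.

Lemma generatedX S f k : generated S f -> generated S (fun z => f z ^+ k).
Proof.
move=> Sf; elim: k => [|k IH].
  by apply: generated_eq (generated_cst S 1) => z0; apply: nearW => z; rewrite expr0.
by apply: generated_eq (generatedM Sf IH) => z0; apply: nearW => z; rewrite exprS.
Qed.

(** Only the variables that occur in Q have to be evaluated in the algebra. *)
Lemma generated_meval S e (u : 'I_e -> C -> C) (Q : mpoly e C) :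
  (forall i, mderiv i Q = 0 \/ generated S (u i)) ->
  generated S (fun z => meval (fun i => u i z) Q).
Proof.
move=> uS.
apply: (@generated_eq _ (fun z => \sum_(m <- msupp Q)
    mcoeff m Q * \prod_(i <- index_enum 'I_e) u i z ^+ m i)).
  by move=> z0; apply: nearW => z; rewrite mevalE.
apply: generated_sum => m mQ; apply: generatedM; first exact: generated_cst.
apply: generated_prod => i; have [Qi0|Sui] := uS i; last exact: generatedX.
rewrite (mderiv_eq0_exponent Qi0 mQ).
by apply: generated_eq (generated_cst S 1) => z0; apply: nearW => z; rewrite expr0.
Qed.

Lemma generated_range_meval e (u : 'I_e -> C -> C) f : generated (range u) f ->
  exists Q : mpoly e C, mero_eq f (fun z => meval (fun i => u i z) Q).
Proof.
elim=> {f} [f [i _ <-]|c|f g _ [P fP] _ [Q gQ]|f g _ [P fP] _ [Q gQ]|f g fg _ [P fP]].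
- by exists (mpolyX _ (mnm1 i)) => z0; apply: nearW => z; rewrite mevalXU.
- by exists (mpolyC _ c) => z0; apply: nearW => z; rewrite mevalC.
- exists (P + Q) => z0; apply: filterS2 (fP z0) (gQ z0) => z -> ->.
  by rewrite mevalD.
- exists (P * Q) => z0; apply: filterS2 (fP z0) (gQ z0) => z -> ->.
  by rewrite mevalM.
- by exists P => z0; apply: filterS2 (fg z0) (fP z0) => z <-.
Qed.

Lemma finite_set_range (T : pointedType) (S : set T) : finite_set S ->
  exists e (u : 'I_e -> T), S = range u.
Proof.
move=> /finite_setP[e]; rewrite card_eq_sym => /card_set_bijP[f [fS _ Sf]].
exists e, (fun i => f i); apply/seteqP; split=> [x /Sf[k ke <-]|_ [i _ <-]].
  by exists (Ordinal ke).
exact/fS/ltn_ord.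
Qed.

Lemma near_dnbhs_forall (I : finType) (z0 : C) (P : I -> C -> Prop) :
  (forall i, \forall z \near z0^', P i z) -> \forall z \near z0^', forall i, P i z.
Proof. by move=> zP; apply: (@filter_forall C I P z0^' _). Qed.

(** With e generators, the e + 1 functions f, f', ..., f^(e) are polynomials in
    the generators, hence satisfy the relation of [polynomials_dependent]. *)
Theorem finite_diff_closed_algebraic S f : finite_set S -> diff_closed S ->
  generated S f -> differentially_algebraic f.
Proof.
move=> /finite_set_range[e [u ->]] uc uf.
have /choice[Q QP] : forall k : 'I_e.+1, exists Q : mpoly e C,
    mero_eq (derive1n k f) (fun z => meval (fun i => u i z) Q).
  by move=> k; exact/generated_range_meval/diff_closed_derive1n.
have [P P0 PQ] := polynomials_dependent Q.
exists e, P; split=> // z0.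
have := near_dnbhs_forall (fun k => QP k z0); apply: filterS => z zQ.
by rewrite (meval_eq _ zQ) PQ.
Qed.

Lemma generated_laurent S f : (forall u z, S u -> laurent_near u z) ->
  generated S f -> forall z, laurent_near f z.
Proof.
move=> Su; elim=> {f} [f Sf z|c z|f g _ IHf _ IHg z|f g _ IHf _ IHg z|f g fg _ IH z].
- exact: Su.
- exact: laurent_cst.
- exact: laurentD.
- exact: laurentM.
- have [N fN] := IH z; exists N; apply: analytic_congr fN.
  by apply: filterS (fg z) => y ->.
Qed.

(** The chain rule for a polynomial in several functions. *)
Lemma has_deriv_meval e (u : 'I_e -> C -> C) (du : 'I_e -> C) z (Q : mpoly e C) :
  (forall i, has_deriv (u i) z (du i)) ->
  has_deriv (fun y => meval (fun i => u i y) Q) z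
    (\sum_i meval (fun i => u i z) (mderiv i Q) * du i).
Proof.
move=> uD.
have leibniz (p q dp dq d : C) :
    (dp * q + p * dq) * d = p * (dq * d) + dp * d * q by ring.
pose good Q := has_deriv (fun y => meval (fun i => u i y) Q) z
    (\sum_i meval (fun i => u i z) (mderiv i Q) * du i).
have congr P h l : has_deriv h z l ->
    (forall y, meval (fun i => u i y) P = h y) ->
    \sum_i meval (fun i => u i z) (mderiv i P) * du i = l -> good P.
  by move=> hl /funext hP lE; rewrite /good hP lE.
have goodC c : good (mpolyC _ c).
  apply: congr (has_deriv_cst c z) _ _ => [y|]; first by rewrite mevalC.
  by rewrite big1// => i _; rewrite mderivC meval0 mul0r.
have goodD P1 P2 : good P1 -> good P2 -> good (P1 + P2).
  move=> g1 g2; apply: congr (has_derivD g1 g2) _ _ => [y|].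
    by rewrite mevalD.
  by rewrite -big_split; apply: eq_bigr => i _; rewrite mderivD mevalD mulrDl.
have goodM P1 P2 : good P1 -> good P2 -> good (P1 * P2).
  move=> g1 g2; apply: congr (has_derivM g1 g2) _ _ => [y|].
    by rewrite mevalM.
  rewrite mulr_sumr mulr_suml -big_split; apply: eq_bigr => i _ /=.
  by rewrite mderivM mevalD !mevalM leibniz.
have goodX i : good (mpolyX _ (mnm1 i)).
  apply: congr (uD i) _ _ => [y|]; first by rewrite mevalXU.
  rewrite (bigD1 i)//= big1 => [|k ki].
    have -> : mderiv i (mpolyX _ (mnm1 i)) = 1 :> mpoly e C.
      rewrite mderivX mnm1E eqxx scale1r -mpolyX0; congr mpolyX.
      by apply/mnmP => k; rewrite mnmBE subnn mnm0E.
    by rewrite meval1 mul1r addr0.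
  by rewrite mderivX mnm1E eq_sym (negbTE ki) scale0r meval0 mul0r.
elim/mpolyind : Q => [|c m P _ _ gP]; first by rewrite -[0]mpolyC0; exact: goodC.
apply: (goodD _ _ _ gP); rewrite -mul_mpolyC; apply: (goodM _ _ (goodC c)).
rewrite mpolyXE_id; apply: (big_ind good) => [|P1 P2|i _].
- by rewrite -mpolyC1; exact: goodC.
- exact: goodM.
- elim: (m i) => [|k IH]; first by rewrite expr0 -mpolyC1; exact: goodC.
  by rewrite exprS; exact: (goodM _ _ (goodX i)).
Qed.

End Generated.

(** * Differentially algebraic functions and the theorem *)

Section AlgebraicToClosed.
Variable R : realType.
Local Notation C := (Cplx R).
Implicit Types (f g u : C -> C) (S T : set (C -> C)).

Lemma laurent_derive1n f k : (forall z, laurent_near f z) ->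
  forall z, laurent_near (derive1n k f) z.
Proof.
by move=> fl; elim: k => [//|k IH] z; have [] := laurent_derive1 (IH z).
Qed.

Lemma laurent_smooth f : (forall z, laurent_near f z) -> smooth f.
Proof. by move=> fl z; have [] := laurent_derive1 (fl z). Qed.

Definition jet m f (z : C) : 'I_m.+1 -> C := fun k => derive1n k f z.
Arguments jet m f z : clear implicits.

(** The derivative of P(f, f', ...) = 0, solved for the highest derivative.
    The sum runs over an explicit filtered list so that [generated_sum]
    applies with the bound i < k available for each term. *)
Lemma separant_relation f m (P : mpoly m.+1 C) (k : 'I_m.+1) :
  (forall z, laurent_near f z) ->
  mero_eq (fun z => meval (jet m f z) P) (fun=> 0) ->
  (forall i : 'I_m.+1, (k < i)%N -> mderiv i P = 0) ->
  mero_eq (fun z => meval (jet m f z) (mderiv k P) * derive1n k.+1 f z)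
    (fun z => - \sum_(i <- [seq i : 'I_m.+1 <- index_enum _ | (i < k)%N])
                  meval (jet m f z) (mderiv i P) * derive1n i.+1 f z).
Proof.
move=> fl Pf kmax z0.
have sm : \forall z \near z0^', forall i : 'I_m.+1,
    has_deriv (derive1n i f) z (derive1n i.+1 f z).
  by apply: near_dnbhs_forall => i; exact: laurent_smooth (laurent_derive1n i fl) z0.
apply: filterS2 (near_dnbhs_near (Pf z0)) sm => z Pz /(has_deriv_meval P) dP.
have := has_deriv_derive1 (has_deriv_near Pz dP).
rewrite (has_deriv_derive1 (has_deriv_cst 0 z)) (bigD1 k)//= => /esym/addr0_eq E.
apply: oppr_inj; rewrite opprK E.
rewrite big_filter [LHS]big_mkcond [RHS]big_mkcond /=.
apply: eq_bigr => i _; rewrite -val_eqE /=.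
case: ltngtP => // ki; by rewrite kmax// meval0 mul0r.
Qed.

(** The algebra is generated by f, ..., f^(k) and the inverse of the separant
    s.  The derivative of 1/s is - s'/s^2, and that of f^(k) is given by
    [separant_relation]; s has isolated zeros because the derivative of P with
    respect to its highest variable is smaller than P and so cannot annihilate
    f. *)
Lemma algebraic_in_finite_closed f : (forall z, laurent_near f z) ->
  differentially_algebraic f ->
  exists S, [/\ finite_set S, diff_closed S & generated S f].
Proof.
move=> fl fda.
pose annihilates m (P : mpoly m.+1 C) :=
  P != 0 /\ mero_eq (fun z => meval (jet m f z) P) (fun=> 0).
pose sizes s := `[< exists m (P : mpoly m.+1 C), annihilates m P /\ msize P = s >].
have exs : exists s, sizes s.
  by have [m [P PP]] := fda; exists (msize P); apply/asboolP; exists m, P.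
have [m [P [[P0 Pf] Pmin]]] : exists m (P : mpoly m.+1 C), annihilates m P /\
    forall Q : mpoly m.+1 C, annihilates m Q -> (msize P <= msize Q)%N.
  case: (ex_minnP exs) => _ /asboolP[m [P [PP <-]]] smin; exists m, P; split=> // Q QP.
  by apply: smin; apply/asboolP; exists m, Q.
have [i0 Pi0] : exists i, mderiv i P != 0.
  apply: nonconstant_mderiv; rewrite ltnNge; apply/negP => /msize1_polyC PC.
  have [z z0] := filter_ex (Pf 0).
  have P00 : mcoeff mnm0 P = 0 by rewrite -[LHS](mevalC (jet m f z)) -PC.
  by move: P0; rewrite PC P00 mpolyC0 eqxx.
have [k Pk kmax] := @arg_maxnP _ i0 (fun i => mderiv i P != 0) (fun i => i : nat) Pi0.
have {}kmax (i : 'I_m.+1) : (k < i)%N -> mderiv i P = 0.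
  by move=> ki; apply/eqP; apply: contraTT ki => /kmax; rewrite -leqNgt.
pose s z := meval (jet m f z) (mderiv k P).
pose T : set (C -> C) := [set derive1n i f | i in `I_k.+1].
have Tgen (Q : mpoly m.+1 C) :
    (forall i : 'I_m.+1, (k < i)%N -> mderiv i Q = 0) ->
    generated T (fun z => meval (jet m f z) Q).
  move=> Qk; apply: (@generated_meval _ _ _ (fun i : 'I_m.+1 => derive1n i f)) => i.
  have [ik|ki] := leqP i k; last by left; exact: Qk.
  by right; apply: generated_mem; exists (i : nat).
have Tder (i : 'I_m.+1) : generated T (fun z => meval (jet m f z) (mderiv i P)).
  by apply: Tgen => l kl; rewrite mderiv_comm kmax// mderiv0.
have sl z : laurent_near s z.
  apply: (generated_laurent _ (Tder k)) => u y [i _ <-].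
  exact: laurent_derive1n.
have sN0 : forall z0 : C, \forall z \near z0^', s z != 0.
  have [s0|//] := identity_theorem sl.
  by have := Pmin _ (conj Pk s0); rewrite leqNgt msize_mderiv_lt.
pose si z := (s z)^-1.
pose S := T `|` [set si].
have TS : T `<=` S by move=> u; left.
have Sis : generated S si by apply: generated_mem; right.
have Tc u : T u -> smooth u /\ generated S (derive1 u).
  move=> [i ik <-]; split; first exact/laurent_smooth/laurent_derive1n.
  have gnext l : (l < k)%N -> generated S (derive1n l.+1 f).
    by move=> lk; apply: generated_mem; left; exists l.+1.
  move: ik; rewrite /= ltnS leq_eqVlt => /orP[/eqP->|/gnext//].
  apply: (@generated_eq _ _ (fun z => si z * (-1 *
     \sum_(l <- [seq l : 'I_m.+1 <- index_enum _ | (l < k)%N])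
        meval (jet m f z) (mderiv l P) * derive1n l.+1 f z))).
    move=> z0; apply: filterS2 (sN0 z0) (separant_relation fl Pf kmax z0).
    by move=> z sz; rewrite mulN1r => <-; rewrite mulKf.
  apply: (generatedM Sis); apply: generatedM; first exact: generated_cst.
  apply: generated_sum => l; rewrite mem_filter => /andP[lk _].
  by apply: generatedM; [exact: generated_mono TS _|exact: gnext].
(* The separant is a polynomial in f, ..., f^(k), whose derivatives are known
   to lie in the algebra generated by S. *)
have [ss ds] := generated_derive1 TS Tc (Tder k).
have si_der z0 : \forall z \near z0^', has_deriv si z (- si z ^+ 2 * derive1 s z).
  by apply: filterS2 (sN0 z0) (ss z0) => z sz; exact: has_derivV.
exists S; split.
- rewrite /S finite_setU; split; last exact: finite_set1.
  exact/finite_image/finite_II.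
- move=> u [/Tc//|->]; split=> [z0|].
    by apply: filterS (si_der z0) => z d; rewrite (has_deriv_derive1 d).
  apply: (@generated_eq _ _ (fun z => (-1 * (si z * si z)) * derive1 s z)).
    move=> z0; apply: filterS (si_der z0) => z d; rewrite (has_deriv_derive1 d).
    by rewrite mulN1r expr2.
  apply: generatedM ds; apply: generatedM (generatedM Sis Sis).
  exact: generated_cst.
- by apply: generated_mem; left; exists 0%N.
Qed.

End AlgebraicToClosed.

Theorem theorem6p2 (R : realType) (n : nat) (B : 'M[Cplx R]_n)
    (phi : 'I_n -> Cplx R -> Cplx R)
    (phi_mero : forall i, meromorphic (phi i))
    (j : 'I_n)
    (phi_j_dt : differentially_transcendental (phi j))
    (phi_da : forall i, i != j -> differentially_algebraic (phi i))
    (x : 'I_n -> Cplx R -> Cplx R)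
    (x_mero : forall i, meromorphic (x i))
    (x_sol : forall i, mero_eq (derive1 (x i))
                         (fun z => \sum_(l < n) B i l * x l z + phi i z)) :
  differentially_transcendental (x j).
Proof.
move=> xj_da; apply: phi_j_dt.
have xl i z : laurent_near (x i) z by exact/meromorphic_laurent/x_mero.
have pl i z : laurent_near (phi i) z by exact/meromorphic_laurent/phi_mero.
(* The functions assumed to be differentially algebraic, indexed by 'I_n with
   x_j in the place of phi_j. *)
pose g i := if i == j then x j else phi i.
have /choice[S_ S_P] : forall i, exists S,
    [/\ finite_set S, diff_closed S & generated S (g i)].
  move=> i; apply: algebraic_in_finite_closed; rewrite /g; case: eqVneq => //.
  by move=> ij; exact: phi_da.
pose S := \bigcup_i S_ i `|` range x.
have SS i : S_ i `<=` S by move=> u Su; left; exists i.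
have Sx i : generated S (x i) by apply: generated_mem; right; exists i.
have Slin i : generated S (fun z => \sum_(l < n) B i l * x l z).
  by apply: generated_sum => l _; apply: (generatedM (generated_cst S (B i l))).
have Sdx : generated S (derive1 (x j)).
  have [_ Sc gj] := S_P j; apply: generated_mono (SS j) _.
  move: gj; rewrite /g eqxx => gj.
  by have [] := generated_derive1 (@subset_refl _ (S_ j)) Sc gj.
apply: (@finite_diff_closed_algebraic _ S).
- rewrite /S finite_setU; split; last exact/finite_image/finite_finset.
  by apply: bigcup_finite => [|i _]; [exact: finite_finset|have [] := S_P i].
- move=> u [[i _ Siu]|[i _ <-]].
    have [_ Sc _] := S_P i; have [? ?] := Sc u Siu.
    by split; last exact: generated_mono (SS i) _.
  split; first exact: laurent_smooth.
  have [->|ij] := eqVneq i j; first exact: Sdx.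
  apply: generated_eq (mero_eqS (x_sol i)) _; apply: (generatedD (Slin i)).
  apply: generated_mono (SS i) _.
  by have [_ _] := S_P i; rewrite /g (negbTE ij).
apply: (@generated_eq _ _ (fun z => derive1 (x j) z + -1 *
    \sum_(l < n) B j l * x l z)).
  move=> z0; apply: filterS (x_sol j z0) => z ->.
  by rewrite mulN1r addrAC subrr add0r.
by apply: (generatedD Sdx); apply: (generatedM (generated_cst S (-1))).
Qed.
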